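(* Consider an algebraic estimator $\eta(u,v)\in\mathbb{R}[u,v]^d$ defined by a vector version of the second-order efficient estimators, that is, by the vector equation $$X=\eta(u,0)+\sum_{i=p+1}^{d} v_{i-p}\, e_i(u)+ c\cdot\sum_{j=1}^p f_j(u,v)\, e_j(u),$$ where, for each $u$, $\{e_j(u);\,j=1,\dots,p\}\cup\{e_i(u);\,i=p+1,\dots,d\}$ is a complete basis of $\mathbb{R}^d$ such that $e_i(u)$ is orthogonal to $\nabla_u\eta$ with respect to the Fisher metric for $i=p+1,\dots,d$; where $f_j(u,v)\in\mathbb{R}[u][v]_{\ge 3}$ for $j=1,\dots,p$; and where $c$ is a constant. Then this estimator is also represented by an algebraic version, that is, by a system of polynomial equations $$(X-\eta_u)^\top\tilde e_j(u,\eta_u)+c\cdot h_j(X,u,\eta_u,X-\eta_u)=0\qquad\text{for } j=1,\dots,p,\qquad \eta_u=\eta(u,0),$$ where $\tilde e_j(u,\eta_u)\in\mathbb{R}[u,\eta_u]^d$, $j=1,\dots,p$, span $((\nabla_u\eta(u,0))^{\perp_{\bar G}})^{\perp_E}$ for every $u$, $h_j(X,u,\eta_u,t)\in\mathbb{R}[X,u,\eta_u][t]_3$, and $$h_j(X,u,\eta_u,t)=\tilde f_j\bigl(u,(\tilde e_i^\top t)_{i=p+1}^d,(\tilde e_i^\top(X-\eta_u))_{i=p+1}^d\bigr)$$ with a function $\tilde f_j(u,v,\tilde v)\in\mathbb{R}[u,\tilde v][v]_3$ such that $\tilde f_j(u,v,v)=f_j(u,v)$. Here each $\tilde e_k$ ($k=1,\dots,d$)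 is a vector that is Euclidean-orthogonal to the subspace $\mathrm{span}(\{e_i\mid i\ne k\})$.
   Context: Full exponential family: $dP(x|\theta)=\exp(\sum_i x_i\theta^i-\psi(\theta))\,d\nu$, $x\in\mathbb{R}^d$, $\theta\in\Theta\subset\mathbb{R}^d$, with carrier measure $\nu$ and potential $\psi$. The expectation parameter is $\eta(\theta)=E[x|\theta]=\nabla_\theta\psi(\theta)$. The Fisher metric with respect to $\theta$ is $g_{ij}=\partial^2\psi/\partial\theta^i\partial\theta^j$, and $\bar G=(g^{ij})$, its inverse matrix, is the Fisher metric with respect to $\eta$. The model is a curved exponential family of dimension $p$, with natural parameter set $\mathcal{V}_\Theta\subset\Theta$ and expectation parameter set $\mathcal{V}_E=\eta(\mathcal{V}_\Theta)\subset\mathbb{R}^d$. It is algebraic: $\mathcal{V}_\Theta$ or $\mathcal{V}_E$ is represented by a real algebraic variety, and the map $\theta\mapsto\eta(\theta)$ or its inverse is locally represented by polynomial equations in $(\theta,\eta)$. It is assumed non-singular around the true parameter. An estimator is given by a local coordinate system $(u,v)\in\mathbb{R}^p\times\mathbb{R}^{d-p}$ around the true parameter, $(u,v)\mapsto\eta(u,v)$, such that $v=0$ gives the model $\mathcal{V}_E$. The sample mean $X\in\mathbb{R}^d$ is written $X=\eta(u,v)$ and the estimate is $u$. The estimator is algebraic if $(u,v)\mapsto\eta(u,v)$ or $(u,v)\mapsto\theta(u,v)$ is represented algebraically. The constant $c$ controls the perturbation from the maximum likelihood estimator, which is the case $c=0$. $\mathbb{R}[u][v]_{\ge3}$ denotes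 the polynomials whose degree in $v$ is at least 3, with coefficients polynomial in $u$. $\mathbb{R}[X,u,\eta_u][t]_3$ denotes the polynomials of degree 3 in $t\in\mathbb{R}^d$ with coefficients in $\mathbb{R}[X,u,\eta_u]$, and $\mathbb{R}[u,\tilde v][v]_3$ is defined similarly. In defining the algebraic version, the degree of a polynomial means the maximum degree of its terms. $(\nabla_u\eta(u,0))^{\perp_{\bar G}}$ is the subspace orthogonal to $\mathrm{span}(\partial_{u^a}\eta(u,0))_{a=1}^p$ with respect to $\bar G$, and $(\cdot)^{\perp_E}$ is the Euclidean orthogonal complement.
   Formalization: All e_k(u) are taken polynomial in u; f̃_j(u,v,v)=f_j(u,v) is claimed only if det(e_1,…,e_d) is a nonzero constant or f_j is homogeneous in v; in general f̃_j(u,sv,sv)=−s_j f_j(u,v), where s_k=ẽ_k^T e_k and (sv)_i=s_{p+i}v_i. The unrestricted claim is false. *)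

(* Defs.v *)
From HB Require Import structures.
From mathcomp Require Import all_boot all_order all_algebra.
From mathcomp Require Import all_classical all_reals all_analysis.
(* Only the instances of [mpoly] are imported: its notations clash with those of
   MathComp-Analysis. *)
From mathcomp Require Import (canonicals, coercions, hints) mpoly.

Set Implicit Arguments.
Unset Strict Implicit.
Unset Printing Implicit Defensive.

Import Order.TTheory GRing.Theory Num.Theory.
Import numFieldNormedType.Exports.

Local Open Scope classical_set_scope.
Local Open Scope ring_scope.

Notation mpol A n := (mpoly.mpoly n A).

Section Evaluation.
Variable R : realType.

Definition ev n (x : 'rV[R]_n) (P : mpol R n) : R := mpoly.meval (x 0) P.

Definition ev_mx k l n (x : 'rV[R]_n) (A : 'M[mpol R n]_(k, l)) : 'M[R]_(k, l) :=
  map_mx (ev x) A.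

(* [mpol (mpol R m) n] is the ring R[y][x], with m coefficient variables y and
   n main variables x. *)
Definition ev2 m n (y : 'rV[R]_m) (x : 'rV[R]_n) (P : mpol (mpol R m) n) : R :=
  mpoly.mmap (ev y) (x 0) P.

(* R[y][x]_{>= k}: every monomial in x has degree at least k. *)
Definition degree_ge m n (k : nat) (P : mpol (mpol R m) n) : Prop :=
  forall mon, mon \in mpoly.msupp P -> (k <= mpoly.mdeg mon)%N.

(* R[y][x]_k: the maximal degree in x of the monomials is exactly k; the zero
   polynomial is included. [msize] is one more than this maximal degree. *)
Definition degree_eq m n (k : nat) (P : mpol (mpol R m) n) : Prop :=
  P = 0 \/ mpoly.mmeasure mpoly.mdeg P = k.+1.

Definition homogeneous m n (P : mpol (mpol R m) n) : Prop :=
  exists k, forall mon, mon \in mpoly.msupp P -> mpoly.mdeg mon = k.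

Definition dot n (x y : 'rV[R]_n) : R := \sum_i x 0 i * y 0 i.

(* The rows of S span a subspace of R^n, and the rows of [orth G S] its
   orthogonal for the bilinear form x G y^T. *)
Definition orth m n (G : 'M[R]_n) (S : 'M[R]_(m, n)) : 'M[R]_n :=
  kermx (G *m S^T).

Definition perpE m n (S : 'M[R]_(m, n)) : 'M[R]_n := orth 1%:M S.

(* Row i is the gradient of the i-th polynomial. *)
Definition poly_jacobian k n (F : 'I_k -> mpol R n) (x : 'rV[R]_n) : 'M[R]_(k, n) :=
  \matrix_(i, j) ev x (mpoly.mderiv j (F i)).

End Evaluation.

Section ExponentialFamily.
Variables (R : realType) (d : nat).
Variable nu : {measure set (d.-tuple R) -> \bar R}.
Variables (Theta : set 'rV[R]_d) (psi : 'rV[R]_d -> R).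

Definition density (th : 'rV[R]_d) (x : d.-tuple R) : R :=
  expR (\sum_i tnth x i * th 0 i - psi th).

(* eta(theta) = E[x | theta] *)
Definition expectation_param (th : 'rV[R]_d) : 'rV[R]_d :=
  \row_i \int[nu]_x (tnth x i * density th x).

Definition fisher (th : 'rV[R]_d) : 'M[R]_d :=
  \matrix_(i, j) 'D_(delta_mx 0 i) ('D_(delta_mx 0 j) psi) th.

Definition fisher_inv (th : 'rV[R]_d) : 'M[R]_d := invmx (fisher th).

(* Theta is open so that the derivatives of psi make sense on it. *)
Definition exponential_family : Prop :=
  [/\ open Theta,
      forall th, Theta th -> (\int[nu]_x (density th x)%:E = 1)%E
    & forall th, Theta th -> fisher th \in unitmx].

Definition zero_set n (S : seq (mpol R n)) : set 'rV[R]_n :=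
  [set x | forall P, P \in S -> ev x P = 0].

(* V is cut out in D by polynomial equations whose Jacobian has rank d - p at
   all points of V near x0. *)
Definition nonsingular_variety (p : nat) (D V : set 'rV[R]_d) (x0 : 'rV[R]_d) :=
  exists S : seq (mpol R d),
    V = D `&` zero_set S /\
    \forall x \near x0, V x ->
      (p + \rank (poly_jacobian (tnth (in_tuple S)) x))%N = d.

(* The equations F(theta, eta) = 0 describe the graph of theta |-> eta(theta),
   which is also that of the inverse map, near (th0, eta(th0)). *)
Definition algebraic_link (th0 : 'rV[R]_d) :=
  exists S : seq (mpol R (d + d)),
    \forall th \near th0 & et \near expectation_param th0,
      (Theta th /\ expectation_param th = et) <-> zero_set S (row_mx th et).

Definition algebraic_curved_family (p : nat) (VTheta : set 'rV[R]_d)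
    (th0 : 'rV[R]_d) : Prop :=
  [/\ VTheta `<=` Theta, VTheta th0,
      nonsingular_variety p Theta VTheta th0 \/
      nonsingular_variety p (expectation_param @` Theta)
        (expectation_param @` VTheta) (expectation_param th0)
    & algebraic_link th0].

End ExponentialFamily.

Section Estimator.
Variables (R : realType) (p q : nat).
Local Notation d := (p + q)%N.
Variable nu : {measure set (d.-tuple R) -> \bar R}.
Variables (psi : 'rV[R]_d -> R) (VTheta : set 'rV[R]_d).

(* The domain of u: the slice v = 0 of the coordinate domain W. *)
Definition slice (W : set 'rV[R]_d) : set 'rV[R]_p :=
  [set u | W (row_mx u 0)].

Definition eta_at (eta : 'rV[mpol R d]_d) (u : 'rV[R]_p) (v : 'rV[R]_q) :
  'rV[R]_d := ev_mx (row_mx u v) eta.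

(* Row a is the partial derivative of eta(u, 0) with respect to u^a. *)
Definition nabla_u (eta : 'rV[mpol R d]_d) (u : 'rV[R]_p) : 'M[R]_(p, d) :=
  usubmx (poly_jacobian (eta 0) (row_mx u 0))^T.

(* theta(u) is the natural parameter of the point eta(u, 0) of the model. *)
Definition estimator_coordinates (eta : 'rV[mpol R d]_d)
    (theta : 'rV[R]_p -> 'rV[R]_d) (W : set 'rV[R]_d) (u0 : 'rV[R]_p) : Prop :=
  [/\ [/\ open W, slice W u0, {in W &, injective (fun z => ev_mx z eta)}
        & forall z, W z -> poly_jacobian (eta 0) z \in unitmx],
      forall u, slice W u ->
        VTheta (theta u) /\ expectation_param nu psi (theta u) = eta_at eta u 0
    & \forall x \near eta_at eta u0 0,
        (expectation_param nu psi @` VTheta) x ->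
        exists2 u, slice W u & eta_at eta u 0 = x].

(* Row k of E is the k-th vector of the frame: the first p rows are the e_j, the
   last q rows the e_i. *)
Definition frame_at (E : 'M[mpol R p]_d) (u : 'rV[R]_p) : 'M[R]_d := ev_mx u E.

Definition adapted_frame (eta : 'rV[mpol R d]_d)
    (theta : 'rV[R]_p -> 'rV[R]_d) (W : set 'rV[R]_d) (E : 'M[mpol R p]_d) : Prop :=
  forall u, slice W u ->
    [/\ row_free (frame_at E u), row_full (frame_at E u)
      & forall i : 'I_q, (row (rshift p i) (frame_at E u)
          <= orth (fisher_inv psi (theta u)) (nabla_u eta u))%MS].

(* The right-hand side of the vector equation. *)
Definition vector_version (eta : 'rV[mpol R d]_d) (E : 'M[mpol R p]_d)
    (f : 'I_p -> mpol (mpol R p) q) (c : R) (u : 'rV[R]_p) (v : 'rV[R]_q) :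
  'rV[R]_d :=
  eta_at eta u 0
  + \sum_(i < q) v 0 i *: row (rshift p i) (frame_at E u)
  + c *: \sum_(j < p) ev2 u v (f j) *: row (lshift q j) (frame_at E u).

(* In R[u, eta_u] the point eta_u of the model is a block of d indeterminates. *)
Definition dual_at (Et : 'M[mpol R (p + d)]_d) (u : 'rV[R]_p) (y : 'rV[R]_d) :
  'M[R]_d := ev_mx (row_mx u y) Et.

(* ((etilde_i)^T t)_{i = p+1, ..., d} *)
Definition normal_coord (Et : 'M[mpol R (p + d)]_d) (u : 'rV[R]_p)
    (y t : 'rV[R]_d) : 'rV[R]_q :=
  \row_i dot (row (rshift p i) (dual_at Et u y)) t.

(* h in R[X, u, eta_u][t] *)
Definition h_at (h : mpol (mpol R (d + (p + d))) d) (X : 'rV[R]_d)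
    (u : 'rV[R]_p) (y t : 'rV[R]_d) : R := ev2 (row_mx X (row_mx u y)) t h.

(* ftilde in R[u, vtilde][v] *)
Definition ftilde_at (ft : mpol (mpol R (p + q)) q) (u : 'rV[R]_p)
    (v vt : 'rV[R]_q) : R := ev2 (row_mx u vt) v ft.

(* (X - eta_u)^T etilde_j(u, eta_u) + c h_j(X, u, eta_u, X - eta_u) = 0 *)
Definition algebraic_version (eta : 'rV[mpol R d]_d) (Et : 'M[mpol R (p + d)]_d)
    (h : 'I_p -> mpol (mpol R (d + (p + d))) d) (c : R) (X : 'rV[R]_d)
    (u : 'rV[R]_p) : Prop :=
  let y := eta_at eta u 0 in
  forall j : 'I_p,
    dot (X - y) (row (lshift q j) (dual_at Et u y))
    + c * h_at (h j) X u y (X - y) = 0.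

(* The factor s_k = (etilde_k)^T e_k, left free by the orthogonality relations
   that define etilde_k: at X = eta(u, v) one has
   (etilde_i)^T (X - eta_u) = s_i v_i and (etilde_j)^T (X - eta_u) = c s_j f_j,
   so that s_i = 1 and s_j = -1 is the normalized case. *)
Definition dual_factor (eta : 'rV[mpol R d]_d) (Et : 'M[mpol R (p + d)]_d)
    (E : 'M[mpol R p]_d) (u : 'rV[R]_p) (k : 'I_d) : R :=
  dot (row k (dual_at Et u (eta_at eta u 0))) (row k (frame_at E u)).

Definition dual_frame (eta : 'rV[mpol R d]_d) (W : set 'rV[R]_d)
    (E : 'M[mpol R p]_d) (Et : 'M[mpol R (p + d)]_d) : Prop :=
  forall u, slice W u -> forall k,
    dual_factor eta Et E u k != 0 /\
    forall l, l != k ->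
      dot (row k (dual_at Et u (eta_at eta u 0))) (row l (frame_at E u)) = 0.

End Estimator.

(* Main.v *)
Require Import Defs.
From HB Require Import structures.
From mathcomp Require Import all_boot all_order all_algebra.
From mathcomp Require Import all_classical all_reals all_analysis.
From mathcomp Require Import (canonicals, coercions, hints) mpoly.

Set Implicit Arguments.
Unset Strict Implicit.
Unset Printing Implicit Defensive.

Import Order.TTheory GRing.Theory Num.Theory.
Import numFieldNormedType.Exports.

Local Open Scope classical_set_scope.
Local Open Scope ring_scope.

(** At a fixed u let M be the matrix whose rows are the frame e_k(u) and write
    X - eta_u = a M, so that a is the coordinate vector of X - eta_u.  The
    vector equation says that a_i = v_i for i > p and a_j = c f_j(u, v) for
    j <= p; eliminating v, it becomes the p equations a_j = c f_j(u, (a_i)_i).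
    A frame etilde that is dual to e up to factors, etilde_k . e_l = s_k if
    k = l and 0 otherwise, reads these coordinates off: etilde_k . (X - eta_u)
    is s_k a_k.  Multiplying the j-th equation by s_j gives the algebraic
    version, provided that h_j takes the value - s_j f_j(u, (a_i)_i)
    ([vector_algebraic_version]).

    The dual frame must be polynomial in u.  The rows of the transposed adjugate
    of E are, with s_k = D = det E for all k, and D does not vanish where E(u)
    is invertible; when E is invertible over the polynomials the transposed
    inverse serves, with D = 1 ([dual_polynomial_matrix]).  What remains is to
    express f_j through the dilated coordinates w = D a.  The dilation
    multiplies the part of degree k of f_j by D^k, so that
    D^n f_j(u, a) = sum_m D^(n - deg m) f_(j,m)(u) w^m
    is polynomial in (u, w) as soon as n >= deg f_j.  Hence etilde_j, for
    j <= p, is rescaled by - D^(n - 1), which makes - s_j = D^n.  With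
    n = deg f_j, or with D = 1, this also gives the undilated identity
    ftilde_j(u, v, v) = f_j(u, v) for homogeneous f_j, or for invertible E.

    The degree is made equal to 3 by polarization: each monomial of degree at
    least 3 is split as v^m' vtilde^m'' with m' of degree 3 ([polarize]), and h_j
    arises from ftilde_j by substituting linear forms in t for v
    ([normal_coord_polynomial]).

    Finally the span of the etilde_j is found by counting dimensions.  The
    Fisher metric is nondegenerate and nabla_u eta has rank p, so the Fisher
    orthogonal of nabla_u eta has dimension q and is the span of the e_i; the
    etilde_j are p independent vectors in its p-dimensional Euclidean
    orthogonal ([dual_rows_span]). *)

(** * Evaluation and substitution of polynomials *)

Local Notation homog k := (mpoly.ishomog1 k mpoly.mdeg).

Lemma rmorph_mmap n (A B C : comNzRingType) (g : {rmorphism B -> C})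
    (f : {rmorphism A -> B}) (h : 'I_n -> B) (P : mpol A n) :
  g (mpoly.mmap f h P) = mpoly.mmap (g \o f) (g \o h) P.
Proof.
rewrite rmorph_sum; apply: eq_bigr => m _.
by rewrite rmorphM rmorph_prod; congr (_ * _); apply: eq_bigr => i _; rewrite rmorphXn.
Qed.

Lemma eq_mmap n (A B : comNzRingType) (f1 f2 : A -> B) (h1 h2 : 'I_n -> B)
    (P : mpol A n) :
  f1 =1 f2 -> h1 =1 h2 -> mpoly.mmap f1 h1 P = mpoly.mmap f2 h2 P.
Proof.
move=> ef eh; apply: eq_bigr => m _; rewrite ef; congr (_ * _).
exact: mpoly.mmap1_eq.
Qed.

Section Substitution.
Variable R : realType.

HB.instance Definition _ n (x : 'rV[R]_n) :=
  GRing.RMorphism.copy (ev x) (mpoly.meval (x 0)).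
HB.instance Definition _ m n (y : 'rV[R]_m) (x : 'rV[R]_n) :=
  GRing.RMorphism.copy (ev2 y x) (mpoly.mmap (ev y) (x 0)).

Definition subst m n (s : 'I_m -> mpol R n) : mpol R m -> mpol R n :=
  mpoly.mmap (@mpoly.mpolyC n R) s.

HB.instance Definition _ m n (s : 'I_m -> mpol R n) :=
  GRing.RMorphism.copy (subst s) (mpoly.mmap (@mpoly.mpolyC n R) s).

Lemma ev_subst m n (s : 'I_m -> mpol R n) (x : 'rV[R]_n) (P : mpol R m) :
  ev x (subst s P) = ev (\row_i ev x (s i)) P.
Proof.
rewrite /subst (rmorph_mmap (ev x)); apply: eq_mmap => [c|i] /=.
  exact: mpoly.mevalC.
by rewrite mxE.
Qed.

Definition weaken_l m n : mpol R m -> mpol R (m + n) :=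
  subst (fun i => mpoly.mpolyX R (mpoly.mnm1 (lshift n i))).
Definition weaken_r m n : mpol R n -> mpol R (m + n) :=
  subst (fun i => mpoly.mpolyX R (mpoly.mnm1 (rshift m i))).

Lemma ev_X n (x : 'rV[R]_n) i : ev x (mpoly.mpolyX R (mpoly.mnm1 i)) = x 0 i.
Proof. exact: mpoly.mevalXU. Qed.

Lemma ev_weaken_l m n (x : 'rV[R]_m) (y : 'rV[R]_n) P :
  ev (row_mx x y) (weaken_l n P) = ev x P.
Proof.
rewrite ev_subst; congr (ev _ _).
by apply/rowP => i; rewrite mxE ev_X row_mxEl.
Qed.

Lemma ev_weaken_r m n (x : 'rV[R]_m) (y : 'rV[R]_n) P :
  ev (row_mx x y) (weaken_r m P) = ev y P.
Proof.
rewrite ev_subst; congr (ev _ _).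
by apply/rowP => i; rewrite mxE ev_X row_mxEr.
Qed.

Definition subst2 m n m' n' (s : 'I_m -> mpol R m')
    (t : 'I_n -> mpol (mpol R m') n') :
    mpol (mpol R m) n -> mpol (mpol R m') n' :=
  mpoly.mmap (@mpoly.mpolyC n' (mpol R m') \o subst s) t.

Lemma ev2_subst2 m n m' n' (s : 'I_m -> mpol R m')
    (t : 'I_n -> mpol (mpol R m') n') y x P :
  ev2 y x (subst2 s t P) = ev2 (\row_i ev y (s i)) (\row_i ev2 y x (t i)) P.
Proof.
rewrite /subst2 (rmorph_mmap (ev2 y x)); apply: eq_mmap => [c|i] /=.
  by rewrite [LHS]mpoly.mmapC; exact: ev_subst.
by rewrite mxE.
Qed.

Lemma homog_subst2 k m n m' n' (s : 'I_m -> mpol R m')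
    (t : 'I_n -> mpol (mpol R m') n') P :
  (forall i, t i \is homog 1) -> P \is homog k -> subst2 s t P \is homog k.
Proof.
move=> t1 /mpoly.dhomogP Pk; rewrite /subst2 /mpoly.mmap big_seq.
apply: rpred_sum => mon /Pk /= <-; rewrite mpoly.mul_mpolyC.
apply: rpredZ; rewrite mpoly.mdegE /mpoly.mmap1.
elim/big_ind2: _ => [|d1 x d2 y hx hy|i _]; first exact: mpoly.dhomog1.
  exact: mpoly.dhomogM.
by have := mpoly.dhomogMn (mon i) (t1 i); rewrite mul1n.
Qed.

(** Homogeneous polynomials satisfy [degree_eq] because the zero polynomial is
    homogeneous of every degree; unlike [degree_eq], homogeneity of a
    given degree survives sums and linear substitutions, so the constructions
    below establish it instead. *)
Lemma homog_degree_eq k m n (P : mpol (mpol R m) n) :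
  P \is homog k -> degree_eq k P.
Proof.
move=> hP; have [->|nzP] := eqVneq P 0; [by left|right].
have := mpoly.dhomog_msize hP => /(mpoly.dhomog_uniq nzP hP) ->.
by rewrite prednK // lt0n mpoly.mmeasure_poly_eq0.
Qed.

(** * Polarization in degree k *)

Lemma submonomial_of_degree n (mon : mpoly.multinom n) k :
  (k <= mpoly.mdeg mon)%N ->
  exists hd tl, mon = mpoly.mnm_add tl hd /\ mpoly.mdeg hd = k.
Proof.
elim: k => [_|k IH lt_k].
  by exists (mpoly.mnm0), mon; rewrite mpoly.addm0 mpoly.mdeg0.
have [hd [tl [monE hdk]]] := IH (ltnW lt_k).
have tl0 : tl != mpoly.mnm0.
  by apply: contraTneq lt_k => tl0; rewrite monE tl0 mpoly.add0m hdk ltnn.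
have [i tli] : exists i, tl i != 0%N.
  apply/existsP; apply: contraNT tl0; rewrite negb_exists => /forallP tl0.
  by apply/eqP/mpoly.mnmP => i; move: (tl0 i); rewrite negbK mpoly.mnm0E => /eqP.
exists (mpoly.mnm_add hd (mpoly.mnm1 i)), (mpoly.mnm_sub tl (mpoly.mnm1 i)).
split; last by rewrite mpoly.mdegD mpoly.mdeg1 hdk addn1.
rewrite (mpoly.addmC hd) mpoly.addmA mpoly.submK //.
by apply/mpoly.mnm_lepP => j; rewrite mpoly.mnm1E; case: eqP => // <-; rewrite lt0n.
Qed.

Lemma mmap1D n (A : comNzRingType) (h : 'I_n -> A) m1 m2 :
  mpoly.mmap1 h (mpoly.mnm_add m1 m2) = mpoly.mmap1 h m1 * mpoly.mmap1 h m2.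
Proof.
by rewrite -big_split; apply: eq_bigr => i _; rewrite mpoly.mnmDE exprD.
Qed.

Lemma mmap1M n (A : comNzRingType) (a : A) (h : 'I_n -> A) m :
  mpoly.mmap1 (fun i => a * h i) m = a ^+ mpoly.mdeg m * mpoly.mmap1 h m.
Proof.
rewrite mpoly.mdegE -prodrXr -big_split.
by apply: eq_bigr => i _; rewrite exprMn.
Qed.

(** On the diagonal vtilde = v the polarized polynomial only remembers the total
    monomial v^m, whatever the splitting of m was.  The factors D^(N - deg m)
    homogenize f with respect to D, in view of a dilation of v by D. *)
Lemma polarize k m n N (D : mpol R m) (f : mpol (mpol R m) n) :
  degree_ge k f ->
  exists2 ft : mpol (mpol R (m + n)) n, ft \is homog k &
    forall u v, ftilde_at ft u v v =
      \sum_(mon <- mpoly.msupp f)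
         ev u D ^+ (N - mpoly.mdeg mon) * ev u (mpoly.mcoeff mon f) *
         mpoly.mmap1 (v 0) mon.
Proof.
move=> fk.
have /choice[hd hdP] : forall mon : mpoly.multinom n,
    exists hd, (k <= mpoly.mdeg mon)%N ->
    (exists tl, mon = mpoly.mnm_add tl hd) /\ mpoly.mdeg hd = k.
  move=> mon; case: leqP => [|_]; last by exists mon.
  by move=> /submonomial_of_degree[hd [tl [-> hdk]]]; exists hd; split=> //; exists tl.
pose tl mon := mpoly.mnm_sub mon (hd mon).
pose coef mon : mpol R (m + n) :=
  weaken_l n (D ^+ (N - mpoly.mdeg mon) * mpoly.mcoeff mon f) *
  weaken_r m (mpoly.mpolyX R (tl mon)).
exists (\sum_(mon <- mpoly.msupp f) coef mon *: mpoly.mpolyX _ (hd mon)).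
  rewrite big_seq; apply: rpred_sum => mon /fk /hdP[_ hdk].
  by apply: rpredZ; rewrite mpoly.dhomogX; apply/eqP.
move=> u v; rewrite /ftilde_at rmorph_sum /= !big_seq.
apply: eq_bigr => mon /fk /hdP[[tl' monE] _].
rewrite [LHS]mpoly.mmapZ mpoly.mmapX rmorphM /= ev_weaken_l ev_weaken_r rmorphM rmorphXn /=.
rewrite -mulrA; congr (_ * _).
have -> : tl mon = tl' by rewrite /tl {1}monE mpoly.addmK.
by rewrite [in RHS]monE mmap1D [X in X * _]mpoly.mevalX.
Qed.

End Substitution.

(** * Dual frames *)

Section Frames.
Variable R : realType.

Lemma dot_mulmx m n (x : 'rV[R]_n) (A : 'M[R]_(m, n)) i :
  dot x (row i A) = (x *m A^T) 0 i.
Proof. by rewrite mxE; apply: eq_bigr => j _; rewrite !mxE. Qed.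

Lemma dotC n (x y : 'rV[R]_n) : dot x y = dot y x.
Proof. by apply: eq_bigr => i _; rewrite mulrC. Qed.

Lemma mxrank_orth m n (G : 'M[R]_n) (S : 'M[R]_(m, n)) :
  G \in unitmx -> row_free S -> \rank (orth G S) = (n - m)%N.
Proof.
move=> Gu /eqP Sr.
by rewrite mxrank_ker eqmxMfull ?row_full_unit // mxrank_tr Sr.
Qed.

Lemma row_free_usubmx m1 m2 n (A : 'M[R]_(m1 + m2, n)) :
  row_free A -> row_free (usubmx A).
Proof.
move=> /row_freeP[B AB]; apply/row_freeP; exists (lsubmx B).
by rewrite mul_usub_mx mulmx_lsub AB scalar_mx_block block_mxEh row_mxKl col_mxKu.
Qed.

Lemma row_free_dsubmx m1 m2 n (A : 'M[R]_(m1 + m2, n)) :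
  row_free A -> row_free (dsubmx A).
Proof.
move=> /row_freeP[B AB]; apply/row_freeP; exists (rsubmx B).
by rewrite mul_dsub_mx mulmx_rsub AB scalar_mx_block block_mxEh row_mxKr col_mxKd.
Qed.

(** Both spaces have dimension p: the rows of dsubmx M fill orth G N, which has
    dimension q, and the upper rows of B are orthogonal to them. *)
Lemma dual_rows_span p q (G : 'M[R]_(p + q)) (N : 'M[R]_(p, p + q))
    (M B : 'M[R]_(p + q)) (s : 'rV[R]_(p + q)) :
  G \in unitmx -> row_free N -> M \in unitmx -> (forall k, s 0 k != 0) ->
  (dsubmx M <= orth G N)%MS -> B *m M^T = diag_mx s ->
  (usubmx B :=: perpE (orth G N))%MS.
Proof.
move=> Gu Nf Mu s0 MN BM.
have Bf : row_free B.
  rewrite row_free_unit; have: diag_mx s \in unitmx.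
    by rewrite unitmxE det_diag unitfE; apply/prodf_neq0 => k _.
  by rewrite -BM unitmx_mul => /andP[].
have rO : \rank (orth G N) = q by rewrite mxrank_orth // addKn.
have rM : \rank (dsubmx M) = q.
  by apply/eqP; apply: row_free_dsubmx; rewrite row_free_unit.
have rB : \rank (usubmx B) = p by apply/eqP; apply: row_free_usubmx.
have /submxP[C OE] : (orth G N <= dsubmx M)%MS.
  by rewrite -(geq_leqif (mxrank_leqif_sup MN)) rO rM.
have le : (usubmx B <= perpE (orth G N))%MS.
  apply/sub_kermxP; rewrite mul1mx OE trmx_mul mulmxA.
  have -> : usubmx B *m (dsubmx M)^T = 0.
    apply/matrixP => i j; rewrite !mxE.
    transitivity ((B *m M^T) (lshift q i) (rshift p j)).
      by rewrite mxE; apply: eq_bigr => k _; rewrite !mxE.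
    by rewrite BM mxE eq_lrshift.
  by rewrite mul0mx.
apply/eqmxP; rewrite -(geq_leqif (mxrank_leqif_eq le)) rB.
by rewrite mxrank_ker mul1mx mxrank_tr rO addnK.
Qed.

(** The case of an invertible E is kept apart so as to have D = 1 there, which
    the adjugate does not give. *)
Lemma dual_polynomial_matrix p n (E : 'M[mpol R p]_n) :
  exists (D : mpol R p) (A : 'M[mpol R p]_n),
    [/\ A *m E^T = D%:M, E \in unitmx -> D = 1
      & forall u, ev_mx u E \in unitmx -> ev u D != 0].
Proof.
have [Eu|_] := boolP (E \in unitmx).
  exists 1, (invmx E)^T; split=> // [|u _]; last by rewrite rmorph1 oner_eq0.
  by rewrite -trmx_mul mulmxV // trmx1.
exists (\det E), (\adj E)^T; split=> // [|u].
  by rewrite -trmx_mul mul_mx_adj tr_scalar_mx.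
by rewrite unitmxE /ev_mx det_map_mx unitfE.
Qed.

End Frames.

(** * The two versions of the estimator *)

Section Versions.
Variables (R : realType) (p q : nat).
Local Notation d := (p + q)%N.

Lemma vector_versionE (eta : 'rV[mpol R d]_d) (E : 'M[mpol R p]_d) f c u v :
  vector_version eta E f c u v =
  eta_at eta u 0 + row_mx (c *: \row_j ev2 u v (f j)) v *m frame_at E u.
Proof.
rewrite mulmx_sum_row big_split_ord /= [X in _ = _ + X]addrC addrA /vector_version.
congr (_ + _ + _); first by apply: eq_bigr => i _; rewrite row_mxEr.
by rewrite scaler_sumr; apply: eq_bigr => j _; rewrite row_mxEl !mxE scalerA.
Qed.

Lemma dot_frame_coords m n (a : 'rV[R]_m) (s : 'rV[R]_m) (M B : 'M[R]_(m, n)) k :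
  B *m M^T = diag_mx s -> dot (a *m M) (row k B) = s 0 k * a 0 k.
Proof.
move=> BM; rewrite dot_mulmx -mulmxA -[M *m _]trmxK trmx_mul trmxK BM tr_diag_mx.
by rewrite mul_mx_diag mxE mulrC.
Qed.

(** With X = y + a M, the j-th algebraic equation is
    s_j (a_j - c f_j(u, (a_i)_i)) = 0, and the vector equation has a solution v
    only if v = (a_i)_i. *)
Lemma vector_algebraic_version (eta : 'rV[mpol R d]_d)
    (Et : 'M[mpol R (p + d)]_d) (E : 'M[mpol R p]_d)
    (h : 'I_p -> mpol (mpol R (d + (p + d))) d) f c u (s : 'rV[R]_d) :
  let y := eta_at eta u 0 in let M := frame_at E u in
  M \in unitmx -> (forall j, s 0 (lshift q j) != 0) ->
  dual_at Et u y *m M^T = diag_mx s ->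
  (forall j a, h_at (h j) (y + a *m M) u y (a *m M) =
     - s 0 (lshift q j) * ev2 u (rsubmx a) (f j)) ->
  forall X, (exists v, X = vector_version eta E f c u v) <->
    algebraic_version eta Et h c X u.
Proof.
move=> y M Mu s0 BM hE X.
have [a ->] : exists a, X = y + a *m M.
  by exists ((X - y) *m invmx M); rewrite mulmxKV // addrC subrK.
have eqE j : dot (a *m M) (row (lshift q j) (dual_at Et u y))
    + c * h_at (h j) (y + a *m M) u y (a *m M) =
    s 0 (lshift q j) * (a 0 (lshift q j) - c * ev2 u (rsubmx a) (f j)).
  by rewrite (dot_frame_coords _ _ BM) hE mulrBr mulNr mulrN mulrCA.
have yK : y + a *m M - y = a *m M by rewrite addrC addKr.
rewrite /algebraic_version -/y yK; split=> [[v]|aP].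
  rewrite vector_versionE => /addrI /(can_inj (mulmxK Mu)) av j.
  by rewrite eqE av row_mxEl row_mxKr !mxE subrr mulr0.
exists (rsubmx a); rewrite vector_versionE; congr (_ + _ *m _).
rewrite -[LHS]hsubmxK; congr (row_mx _ _); apply/rowP => j.
move/eqP: (aP j); rewrite eqE mulf_eq0 (negbTE (s0 _)) subr_eq0 => /eqP.
by rewrite !mxE.
Qed.

(** The row factors sigma are left open because the power of D that row j needs
    depends on the degree of f_j. *)
Lemma dual_polynomial_frame (E A : 'M[mpol R p]_d) D (sigma : 'I_d -> mpol R p) :
  A *m E^T = D%:M ->
  exists Et : 'M[mpol R (p + d)]_d, forall u y,
    dual_at Et u y *m (frame_at E u)^T = diag_mx (\row_k ev u (sigma k * D)).
Proof.
move=> AE; exists (map_mx (weaken_l d) (diag_mx (\row_k sigma k) *m A)) => u y.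
have -> : dual_at (map_mx (weaken_l d) (diag_mx (\row_k sigma k) *m A)) u y =
    map_mx (ev u) (diag_mx (\row_k sigma k) *m A).
  by apply/matrixP => k l; rewrite !mxE ev_weaken_l.
rewrite /frame_at /ev_mx map_trmx -map_mxM /= -mulmxA AE.
by apply/matrixP => k l; rewrite mul_mx_scalar !mxE mulrnAr raddfMn mulrC.
Qed.

(** Since normal_coord is linear in its last argument, substituting it for v
    yields forms of degree 1 in t, and substituting normal_coord (X - y) for
    vtilde only affects the coefficients. *)
Lemma normal_coord_polynomial k (Et : 'M[mpol R (p + d)]_d)
    (ft : mpol (mpol R d) q) :
  ft \is homog k ->
  exists2 h : mpol (mpol R (d + (p + d))) d, h \is homog k &
    forall X u y t, h_at h X u y t =
      ftilde_at ft u (normal_coord Et u y t) (normal_coord Et u y (X - y)).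
Proof.
move=> ftk.
pose et i l : mpol R (d + (p + d)) := weaken_r d (Et (rshift p i) l).
pose Xv (l : 'I_d) : mpol R (d + (p + d)) :=
  mpoly.mpolyX R (mpoly.mnm1 (lshift (p + d) l)).
pose yv (l : 'I_d) : mpol R (d + (p + d)) :=
  mpoly.mpolyX R (mpoly.mnm1 (rshift d (rshift p l))).
pose coord (i : 'I_d) : mpol R (d + (p + d)) :=
  match fintype.split i with
  | inl a => mpoly.mpolyX R (mpoly.mnm1 (rshift d (lshift d a)))
  | inr i => \sum_l et i l * (Xv l - yv l)
  end.
pose lin (i : 'I_q) : mpol (mpol R (d + (p + d))) d :=
  \sum_l et i l *: mpoly.mpolyX _ (mpoly.mnm1 l).
exists (subst2 coord lin ft).
  apply: homog_subst2 => // i; apply: rpred_sum => l _.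
  by apply: rpredZ; rewrite mpoly.dhomogX /= mpoly.mdeg1.
move=> X u y t; rewrite /h_at ev2_subst2 /ftilde_at; congr (ev2 _ _ _).
  apply/rowP => i; rewrite !mxE /coord; case: (fintype.split i) => [a|{}i] /=.
    by rewrite ev_X row_mxEr row_mxEl.
  rewrite rmorph_sum mxE; apply: eq_bigr => l _.
  rewrite rmorphM rmorphB /= ev_weaken_r !ev_X row_mxEl !row_mxEr.
  by rewrite !mxE.
apply/rowP => i; rewrite !mxE /lin rmorph_sum; apply: eq_bigr => l _.
rewrite [LHS]mpoly.mmapZ mpoly.mmapX mpoly.mmap1U /= [ev _ _]ev_weaken_r.
by rewrite !mxE.
Qed.

(** The exponent N + 1 is the degree of f, so that no power of D is left over on
    the diagonal when f is homogeneous.  It is taken positive, also for f = 0,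
    because one factor D comes from the dual frame itself. *)
Lemma polarize_dilation k (D : mpol R p) (f : mpol (mpol R p) q) :
  degree_ge k.+1 f ->
  exists N, exists2 ft : mpol (mpol R d) q, ft \is homog k.+1 &
    [/\ D = 1 \/ homogeneous f ->
          forall u v, ftilde_at ft u v v = ev2 u v f
      & forall u v, ftilde_at ft u (ev u D *: v) (ev u D *: v) =
          ev u D ^+ N.+1 * ev2 u v f].
Proof.
move=> fk; pose N := (mpoly.mmeasure mpoly.mdeg f).-2; exists N.
have [ft fth ftE] := polarize N.+1 D fk; exists ft => //.
have degN mon : mon \in mpoly.msupp f -> (mpoly.mdeg mon <= N.+1)%N.
  move=> /(mpoly.mmeasure_mnm_lt mpoly.mdeg) /=; rewrite /N.
  by case: mpoly.mmeasure => [|[|n]] //; rewrite ltnS => /leq_trans ->.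
split=> [fD u v|u v].
  rewrite ftE /ev2 /mpoly.mmap !big_seq; apply: eq_bigr => mon fmon.
  suff -> : ev u D ^+ (N.+1 - mpoly.mdeg mon) = 1 by rewrite mul1r.
  case: fD => [->|[K fK]]; first by rewrite rmorph1 expr1n.
  have [f0|fN] : degree_eq K f.
      by apply: homog_degree_eq; apply/mpoly.dhomogP.
    by move: fmon; rewrite f0 mpoly.msupp0.
  have := fk _ fmon; rewrite (fK _ fmon) /N fN /= => K0.
  by rewrite prednK ?subnn ?expr0 // (leq_trans _ K0).
rewrite ftE /ev2 /mpoly.mmap !big_seq mulr_sumr; apply: eq_bigr => mon fmon.
have -> : mpoly.mmap1 ((ev u D *: v) 0) mon =
    ev u D ^+ mpoly.mdeg mon * mpoly.mmap1 (v 0) mon.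
  by rewrite -mmap1M; apply: mpoly.mmap1_eq => i; rewrite mxE.
by rewrite mulrACA -exprD subnK ?degN // [ev u D ^+ _ * _ * _]mulrA.
Qed.

End Versions.

(** * Equivalence of the vector and algebraic versions *)

Theorem theorem2 (R : realType) (p q : nat)
    (nu : {measure set ((p + q).-tuple R) -> \bar R})
    (Theta VTheta : set 'rV[R]_(p + q)) (psi : 'rV[R]_(p + q) -> R)
    (eta : 'rV[mpol R (p + q)]_(p + q)) (theta : 'rV[R]_p -> 'rV[R]_(p + q))
    (W : set 'rV[R]_(p + q)) (u0 : 'rV[R]_p)
    (E : 'M[mpol R p]_(p + q)) (f : 'I_p -> mpol (mpol R p) q) (c : R) :
  exponential_family nu Theta psi ->
  algebraic_curved_family nu Theta psi p VTheta (theta u0) ->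
  estimator_coordinates nu psi VTheta eta theta W u0 ->
  adapted_frame psi eta theta W E ->
  (forall j, degree_ge 3 (f j)) ->
  (forall (u : 'rV[R]_p) (v : 'rV[R]_q),
     eta_at eta u v = vector_version eta E f c u v) ->
  exists (Et : 'M[mpol R (p + (p + q))]_(p + q))
         (h : 'I_p -> mpol (mpol R ((p + q) + (p + (p + q)))) (p + q))
         (ft : 'I_p -> mpol (mpol R (p + q)) q),
    [/\ (* the estimator is represented by the algebraic version *)
        forall u, slice W u -> forall X,
          (exists v, X = eta_at eta u v) <-> algebraic_version eta Et h c X u,
        (* the vectors etilde *)
        dual_frame eta W E Et /\
        (forall u, slice W u ->
          (usubmx (dual_at Et u (eta_at eta u 0))
             :=: perpE (orth (fisher_inv psi (theta u)) (nabla_u eta u)))%MS),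
        (* degrees *)
        (forall j, degree_eq 3 (h j)) /\ (forall j, degree_eq 3 (ft j)),
        (* h in terms of ftilde *)
        forall j X u y t,
          h_at (h j) X u y t =
          ftilde_at (ft j) u (normal_coord Et u y t) (normal_coord Et u y (X - y))
      & (* ftilde in terms of f *)
        (forall j, E \in unitmx \/ homogeneous (f j) ->
          forall u v, ftilde_at (ft j) u v v = ev2 u v (f j)) /\
        (forall j u (v : 'rV[R]_q), slice W u ->
          let s := dual_factor eta Et E u in
          let sv := \row_i (s (rshift p i) * v 0 i) in
          ftilde_at (ft j) u sv sv = - s (lshift q j) * ev2 u v (f j))].
Proof.
move=> [_ _ fisher_unit] [VsubTheta _ _ _] [[_ _ _ jac_unit] on_model _] frame f_ge3 etaE.
have [D [A [AE E1 D0]]] := dual_polynomial_matrix E.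
have /choice[N /choice[ft ftP]] : forall j, exists N, exists ft,
    [/\ ft \is homog 3,
        D = 1 \/ homogeneous (f j) ->
          forall u v, ftilde_at ft u v v = ev2 u v (f j)
      & forall u v, ftilde_at ft u (ev u D *: v) (ev u D *: v) =
          ev u D ^+ N.+1 * ev2 u v (f j)].
  by move=> j; have [N [ft ? [? ?]]] := polarize_dilation D (f_ge3 j); exists N, ft.
(* The factor D of the unscaled dual row is completed to - D ^ (N j + 1). *)
pose sigma (k : 'I_(p + q)) : mpol R p :=
  match fintype.split k with inl j => - D ^+ N j | inr _ => 1 end.
have [Et EtE] := dual_polynomial_frame sigma AE.
have /choice[h hP] : forall j, exists h : mpol (mpol R (p + q + (p + (p + q)))) (p + q),
    h \is homog 3 /\ forall X u y t, h_at h X u y t =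
      ftilde_at (ft j) u (normal_coord Et u y t) (normal_coord Et u y (X - y)).
  by move=> j; have [ft3 _ _] := ftP j; have [h] := normal_coord_polynomial Et ft3; exists h.
pose s u : 'rV[R]_(p + q) := \row_k ev u (sigma k * D).
have s_l u j : s u 0 (lshift q j) = - ev u D ^+ (N j).+1.
  rewrite mxE /sigma -[lshift q j]/(unsplit (inl j)) unsplitK.
  by rewrite rmorphM rmorphN rmorphXn exprSr mulNr.
have s_r u i : s u 0 (rshift p i) = ev u D.
  by rewrite mxE /sigma -[rshift p i]/(unsplit (inr i)) unsplitK mul1r.
have frame_unit u : slice W u -> frame_at E u \in unitmx.
  by move=> /frame[Ef _ _]; rewrite -row_free_unit.
have s0 u : slice W u -> forall k, s u 0 k != 0.
  move=> /frame_unit /D0 Du k; rewrite -(splitK k); case: fintype.split => i.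
    by rewrite s_l oppr_eq0 expf_neq0.
  by rewrite s_r.
have dotE u y k l : dot (row k (dual_at Et u y)) (row l (frame_at E u)) =
    s u 0 k *+ (k == l).
  by rewrite dot_mulmx -row_mul EtE !mxE.
have factorE u k : dual_factor eta Et E u k = s u 0 k.
  by rewrite /dual_factor dotE eqxx.
have ftD j u v : ftilde_at (ft j) u (ev u D *: v) (ev u D *: v) =
    - s u 0 (lshift q j) * ev2 u v (f j).
  by have [_ _ ->] := ftP j; rewrite s_l opprK.
exists Et, h, ft; split.
- move=> u Wu X.
  have -> : (exists v, X = eta_at eta u v) <->
            (exists v, X = vector_version eta E f c u v).
    by split=> -[v Xv]; exists v; rewrite Xv etaE.
  apply: vector_algebraic_version (frame_unit _ Wu) _ (EtE _ _) _ _ => [j|j a].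
    exact: s0.
  have [_ ->] := hP j; rewrite addrC addKr.
  suff -> : normal_coord Et u (eta_at eta u 0) (a *m frame_at E u) =
      ev u D *: rsubmx a by apply: ftD.
  apply/rowP => i; rewrite !mxE dotC (dot_frame_coords _ _ (EtE _ _)).
  by rewrite -/(s u) s_r.
- split=> u Wu; first by move=> k; rewrite factorE s0 //; split=> // l /negbTE lk;
    rewrite dotE eq_sym lk.
  have [_ _ orthE] := frame u Wu; have [VT _] := on_model u Wu.
  apply: dual_rows_span (frame_unit _ Wu) (s0 _ Wu) _ (EtE _ _).
  + by rewrite unitmx_inv; apply/fisher_unit/VsubTheta.
  + by apply: row_free_usubmx; rewrite row_free_unit unitmx_tr; apply: jac_unit.
  + by apply/row_subP => i; rewrite row_dsubmx; apply: orthE.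
- split=> j; first by apply: homog_degree_eq; case: (hP j).
  by apply: homog_degree_eq; case: (ftP j).
- by move=> j; case: (hP j).
- split=> [j Ef|j u v Wu] /=.
    have [_ ftE _] := ftP j; apply: ftE; case: Ef => [/E1|]; by [left|right].
  rewrite factorE.
  by have -> : \row_i (dual_factor eta Et E u (rshift p i) * v 0 i) = ev u D *: v
    by apply/rowP => i; rewrite !mxE factorE s_r.
Qed.
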